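(* Let $q=2^m$ with $m\ge 3$ an integer, and let $G=\langle a,b\rangle\le\mathfrak{S}_q$ be the group described in the context. Let $f_1$ be a permutation group polynomial over $\mathbb{F}_q$ corresponding to $G$, and let $\mathcal{P}_{f_1}$ be the number of permutation group polynomials over $\mathbb{F}_q$ of the same form as $f_1$. Then $$\mathcal{P}_{f_1}=\frac{(2^m!)^2}{2^{2m-1}\phi(2^{m-1})}.$$
   Context: $\phi$ is Euler's totient function. $\mathfrak{S}_q$ is the symmetric group on $\mathbb{F}_q=\{c_0,\ldots,c_{q-1}\}$ (a fixed enumeration); permutations are composed right to left. The permutations are $a=(c_0,c_1)(c_2,c_3)\cdots(c_{q-2},c_{q-1})$ and $$b=(c_{\frac q2-2},c_{\frac q2-4},\ldots,c_2,c_0,\;c_{\frac q2},c_{\frac q2+2},\ldots,c_{q-4},c_{q-2})\,(c_1,c_3,\ldots,c_{\frac q2-1},\;c_{q-1},c_{q-3},\ldots,c_{\frac q2+1}),$$ a product of two disjoint cycles of length $\frac q2$ (in each cycle, indices move in steps of $2$ within each of the two runs). It is known that $|a|=2$, $|b|=\frac q2$, $ab=b^{-1}a$, that $G=\langle a,b\rangle=\{b^ja^i: 0\le j\le \frac q2-1,\ 0\le i\le 1\}$ has order $q$, and that no non-identity element of $G$ has a fixed point. Functions $\mathbb{F}_q^2\to\mathbb{F}_q$ are identified with polynomials in $\mathbb{F}_q[X_1,X_2]$ of degree less than $q$ in each variable (these are the polynomials being counted). A bivariate polynomial $f$ is a local permutation polynomial (LPP) if for every $c\in\mathbb{F}_q$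 both $x\mapsto f(x,c)$ and $x\mapsto f(c,x)$ are bijections of $\mathbb{F}_q$. Bivariate LPPs are in bijection with permutation polynomial tuples, i.e. tuples $\underline{\beta}_f=(\beta_0,\ldots,\beta_{q-1})\in\mathfrak{S}_q^q$ such that $\beta_i\beta_j^{-1}$ has no fixed point for $i\ne j$, via $f(x,\beta_i(x))=c_i$ for all $x\in\mathbb{F}_q$ and all $i$. An LPP is a permutation group polynomial if the entries of its tuple form a subgroup of $\mathfrak{S}_q$, and it then corresponds to that subgroup. Two permutation group polynomials over $\mathbb{F}_q$ are of the same form if their corresponding subgroups of $\mathfrak{S}_q$ are isomorphic as groups. *)

(* Defs.v *)
From HB Require Import structures.
From mathcomp Require Import all_boot all_order all_algebra all_fingroup.
From mathcomp Require Export mpoly.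

Set Implicit Arguments.
Unset Strict Implicit.
Unset Printing Implicit Defensive.

Import GRing.Theory.
Local Open Scope ring_scope.

(* MathComp composes permutations left to right, the opposite of the usual
   right-to-left convention.  Which sets of permutations are subgroups, which
   subgroup two permutations generate, and whether two subgroups are isomorphic
   do not depend on this choice, and the products taken below are products of
   disjoint cycles. *)

(* The cycle (x_1, x_2, ..., x_k), mapping x_1 to x_2, ..., x_k to x_1.
   The undup makes the definition total; it is the identity on lists without
   repetition, the only ones of interest. *)
Definition cycle_perm (T : finType) (s : seq T) : {perm T} :=
  perm (can_inj (prev_next (undup_uniq s))).

Definition index_cycle1 (q : nat) : seq nat :=
  rev [seq i.*2 | i <- iota 0 (q %/ 4)]
    ++ [seq q./2 + i.*2 | i <- iota 0 (q %/ 4)]%N.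

Definition index_cycle2 (q : nat) : seq nat :=
  [seq i.*2.+1 | i <- iota 0 (q %/ 4)]
    ++ rev [seq (q./2 + i.*2).+1 | i <- iota 0 (q %/ 4)]%N.

Section Permutations.

Variables (F : finFieldType) (q : nat) (c : q.-tuple F).

Definition perm_a : {perm F} :=
  (\prod_(i < q./2) cycle_perm (T := F) [:: c`_(i.*2); c`_(i.*2.+1)])%g.

Definition perm_b : {perm F} :=
  (cycle_perm (T := F) [seq c`_i | i <- index_cycle1 q]
   * cycle_perm (T := F) [seq c`_i | i <- index_cycle2 q])%g.

Definition group_ab : {group {perm F}} := <<[set perm_a; perm_b]>>%G.

End Permutations.

Section LocalPermutationPolynomials.

Variable F : finFieldType.

Definition eval2 (f : {mpoly F[2]}) (x y : F) : F := f.@[tnth [tuple x; y]].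

Definition reduced (f : {mpoly F[2]}) : Prop :=
  forall mon : 'X_{1..2}, mon \in msupp f -> forall i : 'I_2, (mon i < #|F|)%N.

Definition is_LPP (f : {mpoly F[2]}) : Prop :=
  forall z : F, bijective (eval2 f ^~ z) /\ bijective (eval2 f z).

Variables (q : nat) (c : q.-tuple F).

(* When c enumerates F and f is an LPP, such a beta exists and is unique, and
   since c has no repetition, beta_i beta_j^-1 has no fixed point for i != j. *)
Definition is_tuple_of (f : {mpoly F[2]}) (beta : q.-tuple {perm F}) : Prop :=
  forall (i : 'I_q) (x : F), eval2 f x (tnth beta i x) = tnth c i.

Definition corresponds_to (f : {mpoly F[2]}) (H : {group {perm F}}) : Prop :=
  [/\ reduced f, is_LPP f &
      exists2 beta : q.-tuple {perm F},
        is_tuple_of f beta & [set s in beta] = H :> {set {perm F}}].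

Definition is_perm_group_poly (f : {mpoly F[2]}) : Prop :=
  exists H : {group {perm F}}, corresponds_to f H.

Definition same_form (f g : {mpoly F[2]}) : Prop :=
  exists H K : {group {perm F}},
    [/\ corresponds_to f H, corresponds_to g K & (H \isog K)%g].

End LocalPermutationPolynomials.

Definition has_card (T : eqType) (P : T -> Prop) (n : nat) : Prop :=
  exists s : seq T, [/\ uniq s, forall x : T, x \in s <-> P x & size s = n].

(* Main.v *)
(* A tuple of permutations comes from an LPP exactly when it acts sharply
   transitively on points, so the polynomials counted are the q! orderings of
   each regular subgroup of Sym(F) isomorphic to G, where q = 2n = 2^m and G is
   dihedral of order 2n.
   A regular dihedral group H has n phi(n) pairs (x, y) of standard generators:
   x generates the cyclic subgroup of order n, and y is one of the n elements
   outside it.  Fix such a pair (b, a) in G and a point p.  The map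
   s |-> ((b^s, a^s), s p) is a bijection from Sym(F) onto pairs of regular
   dihedral generators times points, as G is regular.  Hence
   N * n phi(n) * q = q! for the number N of these subgroups, and the answer is
   N * q!. *)
Require Import Defs.
From mathcomp Require Import all_boot all_order all_algebra all_fingroup.
From mathcomp Require Import cyclic.

Set Implicit Arguments.
Unset Strict Implicit.
Unset Printing Implicit Defensive.

From mathcomp Require Import ring zify.
Import GroupScope.

(** * Dihedral generators *)

(** A rotation of order [n] and a reflection. Keeping [z.2] out of [<[z.1]>] excludes [z.2 = 1] and
    cyclic collapse, so such a pair always generates a group of order [2 * n]. *)
Definition dihedral_pair (gT : finGroupType) (n : nat) (z : gT * gT) : bool :=
  [&& #[z.1] == n, z.2 \notin <[z.1]>, z.2 ^+ 2 == 1 & z.1 ^ z.2 == z.1^-1].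

Section DihedralPairs.

Variables (gT : finGroupType) (n : nat).
Implicit Types (G H : {group gT}) (x y b a : gT).

(** Since [y] inverts [x], it normalises [<[x]>] and the join is a product. As [y] has prime order 2
    and lies outside [<[x]>], the two cyclic groups meet trivially. *)
Lemma dihedral_pair_gen x y : dihedral_pair n (x, y) ->
  <<[set x; y]>> = <[x]> * <[y]> /\ #|<<[set x; y]>>| = (2 * n)%N.
Proof.
case/and4P=> /= /eqP ox yNx /eqP y2 /eqP xy.
have oy : #[y] = 2.
  apply: nt_prime_order => //.
  by apply: contraNneq yNx => ->; rewrite group1.
have E : <<[set x; y]>> = <[x]> * <[y]>.
  rewrite -norm_joinEr; first by rewrite joing_idl joing_idr.
  by rewrite cycle_subG inE -cycleJ xy cycleV.
split=> //.
rewrite E TI_cardMg -?[#|<[_]>|]/(order _) ?ox ?oy 1?mulnC //.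
by rewrite setIC prime_TIg ?cycle_subG // -[#|_|]/(order y) oy.
Qed.

Lemma dihedral_pair_genE H x y : dihedral_pair n (x, y) -> #|H| = (2 * n)%N ->
  x \in H -> y \in H -> <<[set x; y]>> = H.
Proof.
move=> D oH xH yH; apply/eqP.
rewrite eqEcard oH; case: (dihedral_pair_gen D) => _ ->.
by rewrite leqnn andbT gen_subG subUset !sub1set xH.
Qed.

Lemma dihedral_pair_outer H b a t : dihedral_pair n (b, a) ->
  #|H| = (2 * n)%N -> b \in H -> a \in H -> t \in H -> t \notin <[b]> ->
  exists2 u, u \in <[b]> & t = u * a.
Proof.
move=> D oH bH aH tH tNb.
have [E _] := dihedral_pair_gen D.
move: tH; rewrite -(dihedral_pair_genE D oH bH aH) E.
case/mulsgP=> u v ub /cycleP[i ->] tE.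
case/and4P: D => /= _ _ /eqP a2 _.
exists u => //; rewrite tE; congr (_ * _).
rewrite -(expg_mod i a2) modn2.
case Ei : (odd i) => //=; case/negP: tNb.
by rewrite tE -(expg_mod i a2) modn2 Ei expg0 mulg1.
Qed.

(** Conjugation by [t] is trivial on the abelian group [<[b]>], and conjugation by [a] inverts it;
    then [(u * a) ^+ 2 = u * u ^ a = 1]. *)
Lemma dihedral_pair_inv b a u t : dihedral_pair n (b, a) ->
  u \in <[b]> -> t \in <[b]> -> (u ^ (t * a) = u^-1) * ((u * a) ^+ 2 = 1).
Proof.
case/and4P=> /= _ _ /eqP a2 /eqP ba.
have J w : w \in <[b]> -> w ^ a = w^-1.
  by case/cycleP=> i ->; rewrite conjXg ba expgVn.
move=> ub tb; split.
  rewrite conjgM (conjgE u) (centsP (cycle_abelian b) u ub t tb) mulKg.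
  exact: J.
rewrite expgS expg1 -mulgA.
have -> : a * (u * a) = u ^ a.
  by rewrite conjgE; congr (_ * _); apply/esym/eqP; rewrite eq_invg_mul -a2.
by rewrite J // mulgV.
Qed.

Lemma card_dihedral_pairs H b a : (2 < n)%N -> #|H| = (2 * n)%N ->
  dihedral_pair n (b, a) -> b \in H -> a \in H ->
  #|[set z : gT * gT | [&& z.1 \in H, z.2 \in H & dihedral_pair n z]]|
    = (totient n * n)%N.
Proof.
move=> n2 oH D bH aH.
have ob : #[b] = n by case/and4P: D => /eqP.
have sbH : <[b]> \subset H by rewrite cycle_subG.
transitivity #|setX [set x | generator <[b]> x] (H :\: <[b]>)|; last first.
  rewrite cardsX -totient_gen ob cardsD (setIidPr sbH) oH.
  by rewrite -[#|<[b]>|]/(order b) ob mul2n -addnn addnK.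
apply: eq_card => -[x y]; rewrite !inE /=.
apply/and3P/and3P => [[xH yH Dxy]|[gx yNb yH]].
  have /and4P[/= /eqP ox yNx _ _] := Dxy.
  have xb : x \in <[b]>.
    (* Elements of [H] outside [<[b]>] square to 1, so none has order [n > 2]. *)
    apply/negP => /negP xNb.
    have [u ub xE] := dihedral_pair_outer D oH bH aH xH xNb.
    have := order_dvdn x 2; rewrite xE (dihedral_pair_inv D ub ub).2 eqxx.
    by rewrite -xE ox => /(@dvdn_leq n 2 isT); rewrite leqNgt n2.
  have gx : <[b]> == <[x]>.
    by rewrite eq_sym eqEcard cycle_subG xb -!/(order _) ox ob /=.
  by split=> //; rewrite /generator ?(eqP gx).
have xb : x \in <[b]> by rewrite (eqP gx) cycle_id.
have [u ub yE] := dihedral_pair_outer D oH bH aH yH yNb.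
split=> //; first exact: (subsetP sbH).
apply/and4P; split=> /=.
- by rewrite /order -(eqP gx) -/(order b) ob.
- by rewrite -(eqP gx).
- by rewrite yE (dihedral_pair_inv D ub ub).2.
- by rewrite yE (dihedral_pair_inv D xb ub).1.
Qed.

End DihedralPairs.

Lemma injm_dihedral_pair (aT rT : finGroupType) (G : {group aT})
    (f : {morphism G >-> rT}) n b a : 'injm f -> b \in G -> a \in G ->
  dihedral_pair n (b, a) -> dihedral_pair n (f b, f a).
Proof.
move=> injf bG aG /and4P[/= ob aNb /eqP a2 /eqP ba].
apply/and4P; split=> /=.
- by rewrite (order_injm injf).
- apply: contra aNb; rewrite -morphim_cycle // => /morphimP[u uG ub].
  by move/(injmP injf) => ->.
- by rewrite -morphX // a2 morph1.
- by rewrite -morphJ // ba morphV.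
Qed.

(** If [a] were in [<[b]>], the group would be abelian, so [b = b^-1] and the order would be at most
    2. Hence [(b, a)] is dihedral for [#[b]], and comparing group orders gives [#[b] = n]. *)
Lemma dihedral_pair_of_relations (gT : finGroupType) n (b a : gT) :
  (2 < n)%N -> a ^+ 2 = 1 -> b ^ a = b^-1 -> #|<<[set b; a]>>| = (2 * n)%N ->
  dihedral_pair n (b, a).
Proof.
move=> n2 a2 ba oG.
have aNb : a \notin <[b]>.
  apply/negP => ab; move: oG.
  have -> : <<[set b; a]>> = <[b]>.
    apply/eqP; rewrite eqEsubset gen_subG subUset !sub1set cycle_id ab.
    by rewrite cycle_subG mem_gen // !inE eqxx.
  have b2 : b ^+ 2 = 1.
    apply/eqP; rewrite expgS expg1 -eq_invg_mul -ba.
    by apply/eqP/conjg_fixP/commgP/(centsP (cycle_abelian b)); rewrite ?cycle_id.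
  rewrite -[#|_|]/(order b) => ob.
  have : (#[b] <= 2)%N by apply: dvdn_leq => //; rewrite order_dvdn b2.
  by rewrite ob; lia.
have D : dihedral_pair #[b] (b, a) by apply/and4P; split; rewrite /= ?a2 ?ba.
have [_] := dihedral_pair_gen D; rewrite oG => /eqP.
by rewrite eqn_pmul2l // => /eqP ->.
Qed.

(** * Regular permutation groups *)

Section RegularGroups.

Variable T : finType.
Implicit Types (H K : {group {perm T}}) (x y b a s : {perm T}).

(** Sharp transitivity; transitivity follows from injectivity by counting. Bare sets are allowed, so
    that it applies to the entries of any tuple. *)
Definition regular (H : {set {perm T}}) : bool :=
  (#|H| == #|T|) && [forall p, dinjectiveb (fun h : {perm T} => h p) H].

Lemma regular_inj (H : {set {perm T}}) p : regular H ->
  {in H &, injective (fun h : {perm T} => h p)}.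
Proof. by case/andP=> _ /forallP/(_ p)/dinjectiveP. Qed.

Lemma card_regular (H : {set {perm T}}) : regular H -> #|H| = #|T|.
Proof. by case/andP=> /eqP. Qed.

Lemma regular_surj (H : {set {perm T}}) p t : regular H ->
  exists2 h : {perm T}, h \in H & h p = t.
Proof.
move=> rH; have inj := @regular_inj H p rH.
have : [set h p | h : {perm T} in H] == setT.
  by rewrite eqEcard subsetT cardsT card_in_imset ?card_regular /=.
by move/eqP/setP/(_ t); rewrite in_setT => /imsetP[h hH ->]; exists h.
Qed.

Lemma regularJ (H : {set {perm T}}) s : regular H -> regular (H :^ s).
Proof.
move=> rH; apply/andP; split; first by rewrite cardJg card_regular.
apply/forallP=> p; apply/dinjectiveP.
move=> _ _ /imsetP[h hH ->] /imsetP[k kH ->].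
rewrite -(permKV s p) !permJ => /perm_inj E.
by congr (_ ^ s); apply: (regular_inj rH) E.
Qed.

(* The subgroup D of the square generated by (b, x) and (a, y) is the graph of
   an isomorphism, and both coordinates of D act regularly on the points. *)
Lemma regular_dihedral_conj n b a x y p r : #|T| = (2 * n)%N ->
  dihedral_pair n (b, a) -> dihedral_pair n (x, y) ->
  regular <<[set b; a]>> -> regular <<[set x; y]>> ->
  exists s : {perm T}, [/\ b ^ s = x, a ^ s = y & s p = r].
Proof.
move=> oT Dba Dxy rH rK.
pose D := <<[set (b, x); (a, y)]>>.
(* The two generators form a dihedral pair in the direct product, since every relation holds
   coordinatewise. *)
have oD : #|D| = #|T|.
  have [] := @dihedral_pair_gen _ n (b, x) (a, y); last by rewrite oT.
  case/and4P: Dba => /= /eqP ob aNb /eqP a2 /eqP ba.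
  case/and4P: Dxy => /= /eqP ox yNx /eqP y2 /eqP xy.
  have X i : (b, x) ^+ i = (b ^+ i, x ^+ i).
    by elim: i => // i IH; rewrite !expgS IH.
  apply/and4P; split=> /=.
  - rewrite eqn_dvd; apply/andP; split.
      by rewrite order_dvdn X -{1}ob -ox !expg_order.
    have := expg_order (b, x); rewrite X => -[] /eqP + _.
    by rewrite -order_dvdn ob.
  - apply: contra aNb => /cycleP[i]; rewrite X => -[-> _].
    exact: mem_cycle.
  - by rewrite expgS expg1; apply/eqP; congr (_, _).
  - by apply/eqP; congr (_, _).
(* Projection maps [D] onto a group of the same order, so it is injective; regularity of the image
   then lets one point determine an element of [D]. *)
have inj1 : {in D &, injective (fun d : {perm T} * {perm T} => d.1 p)}.
  have fD : fst @: D = <<[set b; a]>>.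
    have := morphim_gen (fst_morphism _ _) (subsetT [set (b, x); (a, y)]).
    rewrite !morphimEsub ?subsetT //= => ->.
    by rewrite imsetU !imset_set1.
  have i1 : {in D &, injective fst}.
    by apply/imset_injP; rewrite fD oD (card_regular rH).
  move=> d e dD eD E; apply: i1 => //.
  by apply: (regular_inj rH) E; rewrite -fD imset_f.
have inj2 : {in D &, injective (fun d : {perm T} * {perm T} => d.2 r)}.
  have fD : snd @: D = <<[set x; y]>>.
    have := morphim_gen (snd_morphism _ _) (subsetT [set (b, x); (a, y)]).
    rewrite !morphimEsub ?subsetT //= => ->.
    by rewrite imsetU !imset_set1.
  have i1 : {in D &, injective snd}.
    by apply/imset_injP; rewrite fD oD (card_regular rK).
  move=> d e dD eD E; apply: i1 => //.
  by apply: (regular_inj rK) E; rewrite -fD imset_f.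
have dP t : exists d : {perm T} * {perm T}, (d \in D) && (d.1 p == t).
  have : [set d.1 p | d : {perm T} * {perm T} in D] == setT.
    by rewrite eqEcard subsetT cardsT card_in_imset ?oD /=.
  move/eqP/setP/(_ t); rewrite in_setT => /imsetP[d dD ->].
  by exists d; rewrite dD eqxx.
(* [d t] is the element of [D] whose first coordinate sends [p] to [t]; [s] sends [t] to the image
   of [r] under its second coordinate. *)
pose d t := xchoose (dP t).
have dD t : d t \in D by case/andP: (xchooseP (dP t)).
have d1 t : (d t).1 p = t by case/andP: (xchooseP (dP t)) => _ /eqP.
have sinj : injective (fun t => (d t).2 r).
  by move=> t u /(inj2 _ _ (dD t) (dD u)) E; rewrite -(d1 t) -(d1 u) E.
pose s := perm sinj.
have sE (e : {perm T} * {perm T}) : e \in D -> s (e.1 p) = e.2 r.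
  by move=> eD; rewrite permE; rewrite (inj1 (d (e.1 p)) e) ?d1.
have conj_s e : e \in D -> e.1 ^ s = e.2.
  move=> eD; apply/permP=> t; rewrite -(permKV s t) permJ.
  set u := s^-1 t; rewrite -(d1 u) sE //.
  (* The left factor of a product acts first, so this reads [s (e.1 u) = e.2 (s u)]. *)
  have := sE (d u * e) (groupM (dD u) eD).
  by rewrite /= !permM.
exists s; split.
- by apply: (conj_s (b, x)); rewrite mem_gen // !inE eqxx.
- by apply: (conj_s (a, y)); rewrite mem_gen // !inE eqxx orbT.
- by have := sE 1 (group1 _); rewrite /= !perm1.
Qed.

(** * Counting regular dihedral pairs and subgroups *)

Definition regular_dihedral_pairs n : {set {perm T} * {perm T}} :=
  [set z | dihedral_pair n z && regular <<[set z.1; z.2]>>].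

Lemma card_regular_dihedral_pairs n b a : #|T| = (2 * n)%N ->
  (b, a) \in regular_dihedral_pairs n ->
  (#|regular_dihedral_pairs n| * #|T| = #|T|`!)%N.
Proof.
move=> oT; rewrite inE /= => /andP[Dba rH].
have [p _ | T0] := pickP T; last first.
  case/and4P: Dba => /= /eqP ob _ _ _.
  by move: oT; rewrite eq_card0 // -ob; have := order_gt0 b; case: #[b].
pose f s := ((b ^ s, a ^ s), s p).
have finj : injective f.
  move=> s t [bE aE pE]; apply/permP=> u.
  have [h hH <-] := regular_surj p u rH.
  (* [s] and [t] conjugate both generators alike, hence every [h] of the group; agreement at [p]
     then spreads to every point [h p]. *)
  have hC : h \in 'C[s * t^-1].
    apply: subsetP hH; rewrite gen_subG subUset !sub1set.
    by apply/andP; split; apply/cent1P/commgP/conjg_fixP;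
       rewrite conjgM ?bE ?aE conjgK.
  have hst : h ^ s = h ^ t.
    move/cent1P/commgP/conjg_fixP: hC => /(congr1 (conjg^~ t)).
    by rewrite conjgM conjgKV.
  have := permJ h s p; have := permJ h t p.
  by rewrite hst pE => -> ->.
transitivity #|f @: setT|; last first.
  rewrite card_imset // -[in RHS]cardsT -card_perm cardsT.
  by apply: eq_card => s; rewrite !inE; apply/esym/subsetP.
rewrite -[#|T|]cardsT -cardsX; congr #|pred_of_set _|; apply/setP=> -[[x y] r].
rewrite !inE /= andbT; apply/andP/imsetP => [[Dxy rK]|[s _ [-> -> _]]].
  have [s [bs xs ps]] := regular_dihedral_conj p r oT Dba Dxy rH rK.
  by exists s; rewrite ?inE // /f bs xs ps.
split; first exact: (injm_dihedral_pair (injm_conj [set: _] s)).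
rewrite -!conjg_set1 -conjUg genJ; exact: regularJ.
Qed.

Definition regular_subgroups_isog (G : {group {perm T}}) :
    {set {group {perm T}}} :=
  [set H : {group {perm T}} | regular H && (G \isog H)].

(** Double counting: regular dihedral pairs are sorted by the subgroup they generate, and each fibre
    has [totient n * n] elements. *)
Lemma card_regular_subgroups_isog n b a (G : {group {perm T}}) :
  (2 < n)%N -> #|T| = (2 * n)%N -> dihedral_pair n (b, a) ->
  G = <<[set b; a]>> :> {set _} -> regular G ->
  (#|regular_subgroups_isog G| * (totient n * n) * #|T| = #|T|`!)%N.
Proof.
move=> n2 oT Dba GE rG.
have bG : b \in G by rewrite GE mem_gen // !inE eqxx.
have aG : a \in G by rewrite GE mem_gen // !inE eqxx orbT.
rewrite -(card_regular_dihedral_pairs (n := n) (b := b) (a := a)) //; last first.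
  by rewrite inE /= Dba -GE.
congr (_ * _)%N; rewrite -!sum1_card big_distrl /=.
pose gen (z : {perm T} * {perm T}) := <<[set z.1; z.2]>>%G.
rewrite [RHS](partition_big gen (mem (regular_subgroups_isog G))) /=; last first.
  case=> x y; rewrite !inE /= => /andP[Dxy rK]; rewrite rK /=.
  have [p _ | T0] := pickP T; last first.
    by move: oT; rewrite eq_card0 //; case: (n) n2.
  have rH : regular <<[set b; a]>> by rewrite -GE.
  (* The pair is a conjugate of [(b, a)], so the group it generates is a conjugate of [G]. *)
  have [s [<- <- _]] := regular_dihedral_conj p p oT Dba Dxy rH rK.
  by rewrite -!conjg_set1 -conjUg genJ -GE conj_isog.
apply: eq_bigr => H; rewrite inE mul1n => /andP[rH /isogP[f injf fG]].
have oH : #|H| = (2 * n)%N by rewrite card_regular.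
rewrite -(card_dihedral_pairs n2 oH (injm_dihedral_pair injf bG aG Dba)).
- rewrite -sum1_card; apply: eq_bigl => -[x y]; rewrite !inE /=.
  apply/and3P/andP => [[xH yH Dxy]|[/andP[Dxy _] /eqP <-]].
    have E := dihedral_pair_genE Dxy oH xH yH.
    by rewrite Dxy E rH; split=> //; apply/eqP/val_inj.
  by rewrite Dxy !mem_gen // !inE eqxx ?orbT.
- by rewrite -fG mem_morphim.
- by rewrite -fG mem_morphim.
Qed.

End RegularGroups.

(** * Reduced polynomials in two variables *)

Section ReducedPolynomials.

Variable F : finFieldType.
Local Notation q := #|F|.
Local Open Scope ring_scope.
Import GRing.Theory.

(** The difference of the two sums is a polynomial of degree below [q] vanishing at all [q] elements
    of [F]; [d] extends its coefficients by 0. *)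
Lemma power_sum_inj (k l : 'I_q -> F) :
  (forall x, \sum_i k i * x ^+ i = \sum_i l i * x ^+ i) -> k =1 l.
Proof.
move=> E; pose d i : F := oapp (fun j : 'I_q => k j - l j) 0 (insub i).
have p0 : \poly_(i < q) d i = 0.
  apply: contraTeq (size_poly q d) => pn0; rewrite -ltnNge {1}cardT.
  apply: (max_poly_roots pn0) (enum_uniq F).
  apply/allP=> x _; apply/eqP; rewrite horner_poly.
  under eq_bigr do rewrite /d valK /= mulrBl.
  by rewrite sumrB E subrr.
move=> i; apply/eqP; rewrite -subr_eq0; apply/eqP.
by have := coef_poly q d i; rewrite p0 coef0 ltn_ord /d valK.
Qed.

Definition exponent (i j : nat) : 'X_{1..2} := [multinom [tuple i; j]].

Lemma exponentK (mon : 'X_{1..2}) : exponent (mon ord0) (mon ord_max) = mon.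
Proof.
apply/mnmP=> i; rewrite multinomE (tnth_nth 0%N) /=.
by case: i => [[|[|//]] hi] /=; congr (fun_of_multinom mon _); apply/val_inj.
Qed.

Lemma exponent_inj i j i' j' :
  (exponent i j == exponent i' j') = (i == i') && (j == j').
Proof.
apply/eqP/andP => [E|[/eqP-> /eqP->] //].
have := congr1 (fun m : 'X_{1..2} => (m ord0, m ord_max)) E.
by rewrite /= !multinomE !(tnth_nth 0%N) /= => -[-> ->].
Qed.

Definition poly_of_coef (k : 'I_q -> 'I_q -> F) : {mpoly F[2]} :=
  \sum_i \sum_j k i j *: 'X_[exponent i j].

Lemma mcoeff_poly_of_coef k (i j : 'I_q) :
  (poly_of_coef k)@_(exponent i j) = k i j.
Proof.
rewrite !raddf_sum (bigD1 i) //= raddf_sum (bigD1 j) //=.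
rewrite mcoeffZ mcoeffX eqxx mulr1 !big1 ?addr0 //.
  move=> i' ne; rewrite raddf_sum big1 //= => j' _.
  by rewrite mcoeffZ mcoeffX exponent_inj (inj_eq val_inj) (negPf ne) mulr0.
move=> j' ne; rewrite mcoeffZ mcoeffX exponent_inj !(inj_eq val_inj).
by rewrite (negPf ne) andbF mulr0.
Qed.

Lemma reduced_poly_of_coef k : reduced (poly_of_coef k).
Proof.
move=> mon; rewrite mcoeff_msupp => nz i; rewrite ltnNge.
apply: contraNN nz => big_i; rewrite raddf_sum big1 // => u _.
rewrite raddf_sum big1 //= => v _; rewrite mcoeffZ mcoeffX.
case: eqP => [E|]; last by rewrite mulr0.
move: big_i; rewrite -E multinomE (tnth_nth 0%N).
by case: i => [[|[|//]] hi] /=; rewrite leqNgt ltn_ord.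
Qed.

Lemma reduced_coefE (f : {mpoly F[2]}) : reduced f ->
  f = poly_of_coef (fun i j => f@_(exponent i j)).
Proof.
move=> rf; apply/mpolyP=> mon; pose k (i j : 'I_q) := f@_(exponent i j).
have coef0 (g : {mpoly F[2]}) : reduced g -> ~ (forall i, mon i < q)%N -> g@_mon = 0.
  by move=> rg H; apply: memN_msupp_eq0; apply/negP=> /rg.
have [/forallP H|/forallP H] := boolP [forall i, (mon i < q)%N]; last first.
  by rewrite !coef0 //; apply: reduced_poly_of_coef.
rewrite -[mon]exponentK.
exact/esym/(mcoeff_poly_of_coef k (Ordinal (H ord0)) (Ordinal (H ord_max))).
Qed.

Lemma eval2_poly_of_coef k x y :
  eval2 (poly_of_coef k) x y = \sum_j (\sum_i k i j * x ^+ i) * y ^+ j.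
Proof.
rewrite /eval2 raddf_sum /=.
transitivity (\sum_i \sum_j k i j * x ^+ i * y ^+ j).
  apply: eq_bigr => i _; rewrite raddf_sum; apply: eq_bigr => j _.
  rewrite /= mevalZ mevalX big_ord_recl big_ord1 !multinomE !(tnth_nth 0%N) /=.
  by rewrite !(tnth_nth 0) /= mulrA.
rewrite exchange_big; apply: eq_bigr => j _ /=.
by rewrite mulr_suml.
Qed.

(** One variable at a time: for fixed [x] the coefficients of the powers of [y] agree, and these are
    in turn polynomial functions of [x]. *)
Lemma poly_of_coef_inj k l :
  (forall x y, eval2 (poly_of_coef k) x y = eval2 (poly_of_coef l) x y) ->
  k =2 l.
Proof.
move=> E i j; apply: (power_sum_inj (k := k^~ j) (l := l^~ j)) => x.
by apply: (@power_sum_inj (fun j => \sum_i k i j * x ^+ i)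
  (fun j => \sum_i l i j * x ^+ i)) => y; rewrite -!eval2_poly_of_coef E.
Qed.

Lemma reduced_eval2_inj (f g : {mpoly F[2]}) : reduced f -> reduced g ->
  (forall x y, eval2 f x y = eval2 g x y) -> f = g.
Proof.
move=> /reduced_coefE fE /reduced_coefE gE; rewrite fE gE => /poly_of_coef_inj E.
by apply: eq_bigr => i _; apply: eq_bigr => j _; rewrite E.
Qed.

(* Distinct coefficient families give distinct functions, and both are
   counted by q ^ (q ^ 2), so every function is interpolated. *)
Lemma interpolation (h : F -> F -> F) :
  exists2 f : {mpoly F[2]}, reduced f & forall x y, eval2 f x y = h x y.
Proof.
pose ev (k : {ffun 'I_q * 'I_q -> F}) : {ffun F * F -> F} :=
  [ffun p : F * F => eval2 (poly_of_coef (fun i j => k (i, j))) p.1 p.2].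
have ev_inj : injective ev.
  move=> k l /ffunP E; apply/ffunP=> -[i j].
  apply: (poly_of_coef_inj (k := fun i j : 'I_q => k (i, j))
    (l := fun i j : 'I_q => l (i, j))) => x y.
  by have := E (x, y); rewrite !ffunE.
have [|inv _ evK] := inj_card_bij ev_inj.
  by rewrite !card_ffun !card_prod !card_ord.
exists (poly_of_coef (fun i j => inv [ffun p : F * F => h p.1 p.2] (i, j))).
  exact: reduced_poly_of_coef.
move=> x y; have /ffunP/(_ (x, y)) := evK [ffun p : F * F => h p.1 p.2].
by rewrite !ffunE.
Qed.

End ReducedPolynomials.

(** * The permutations a and b *)

Section CyclePermutations.

Variable T : finType.
Implicit Types s : seq T.

Lemma cycle_permE s : uniq s -> cycle_perm s =1 next s.
Proof. by move=> us x; rewrite permE undup_id. Qed.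

Lemma cycle_permJ s (t : {perm T}) :
  uniq s -> cycle_perm s ^ t = cycle_perm (map t s).
Proof.
move=> us; apply/permP=> x; rewrite -(permKV t x) permJ !cycle_permE //.
  by rewrite next_map //; apply: perm_inj.
by rewrite map_inj_uniq //; apply: perm_inj.
Qed.

Lemma cycle_perm_rev s : uniq s -> cycle_perm (rev s) = (cycle_perm s)^-1.
Proof.
move=> us; apply/permP=> x; apply: (@perm_inj _ (cycle_perm s)).
by rewrite permKV !cycle_permE ?rev_uniq // next_rev // next_prev.
Qed.

Lemma cycle_perm_rot k s : uniq s -> cycle_perm (rot k s) = cycle_perm s.
Proof.
by move=> us; apply/permP=> x; rewrite !cycle_permE ?rot_uniq // next_rot.
Qed.

Lemma cycle_perm2 (x y : T) : x != y -> cycle_perm [:: x; y] = tperm x y.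
Proof.
move=> xy; apply/permP=> z; rewrite cycle_permE /= ?inE ?xy //.
by case: tpermP => [->|->|/eqP/negPf zx /eqP/negPf zy];
  rewrite eq_sym ?eqxx ?(negPf xy) // eq_sym ?zx ?zy // eq_sym.
Qed.

Lemma prod_disjoint_tperm (I : finType) (f g : I -> T) k :
  injective f -> injective g -> (forall i j, f i != g j) ->
  ((\prod_i tperm (f i) (g i)) (f k) = g k)
  * ((\prod_i tperm (f i) (g i)) (g k) = f k).
Proof.
move=> fI gI fg.
(* Induction needs partial products, which leave alone the pairs whose index is not in [r]. *)
suff H (r : seq I) : uniq r ->
    ((\prod_(i <- r) tperm (f i) (g i)) (f k) = if k \in r then g k else f k)
  * ((\prod_(i <- r) tperm (f i) (g i)) (g k) = if k \in r then f k else g k).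
  by rewrite !H ?index_enum_uniq // mem_index_enum.
elim: r => [_|i r IH /= /andP[inr ur]]; first by rewrite !big_nil !perm1.
rewrite !big_cons !permM inE; case: (eqVneq k i) IH => [->|ki] IH /=.
  by rewrite tpermL tpermR !IH // (negPf inr).
by rewrite !tpermD ?IH // ?(inj_eq fI) ?(inj_eq gI) // 1?eq_sym ?fg.
Qed.

End CyclePermutations.

Section IndexCycles.

Variables (q : nat) (q4 : 4 %| q).

Lemma index_cycle1_double i :
  i \in index_cycle1 q -> exists2 k, i = k.*2 & (k < q./2)%N.
Proof.
have qE : q = (q %/ 4 * 4)%N by rewrite divnK.
have hE : q./2 = (q %/ 4 * 2)%N by rewrite [in LHS]qE; lia.
rewrite mem_cat mem_rev => /orP[] /mapP[k]; rewrite mem_iota => /andP[_ lt_k] ->.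
  by exists k => //; lia.
by exists (q %/ 4 + k)%N; lia.
Qed.

Lemma index_cycle1_uniq : uniq (index_cycle1 q).
Proof.
have qE : q = (q %/ 4 * 4)%N by rewrite divnK.
have hE : q./2 = (q %/ 4 * 2)%N by rewrite [in LHS]qE; lia.
rewrite cat_uniq rev_uniq !map_inj_uniq ?iota_uniq /=; try by move=> i j; lia.
rewrite andbT; apply/hasPn=> _ /mapP[i _ ->].
rewrite mem_rev; apply/mapP=> -[j]; rewrite mem_iota; lia.
Qed.

(** The combinatorial reason why [a] inverts [b]: [a] adds 1 to even indices, which turns the first
    cycle into the second one read backwards, up to rotation. *)
Lemma map_succ_index_cycle1 :
  map succn (index_cycle1 q) = rot (q %/ 4) (rev (index_cycle2 q)).
Proof.
rewrite /index_cycle1 /index_cycle2 rev_cat revK.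
rewrite -[X in rot X](size_iota 0 (q %/ 4)).
rewrite -[X in rot X](size_map (fun i => (q./2 + i.*2).+1)) rot_size_cat.
by rewrite map_cat map_rev -!map_comp.
Qed.

End IndexCycles.

(** * Permutation group polynomials *)

Section EnumeratedField.

Variables (F : finFieldType) (q : nat) (c : q.-tuple F).
Hypotheses (oF : #|F| = q) (uc : uniq c).
Local Open Scope ring_scope.
Import GRing.Theory.

Lemma enumeration_nth (x : F) : exists2 k, (k < q)%N & c`_k = x.
Proof.
have [|_ E] := uniq_min_size uc (fun x _ => mem_enum F x).
  by rewrite -cardT oF size_tuple.
have : x \in (c : seq F) by rewrite E mem_enum.
by move/(nthP 0) => [k]; rewrite size_tuple; exists k.
Qed.

Lemma enumeration_eq i j : (i < q)%N -> (j < q)%N -> (c`_i == c`_j) = (i == j).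
Proof. by move=> iq jq; rewrite nth_uniq ?size_tuple. Qed.

Lemma perm_aE k : (k < q./2)%N ->
  (perm_a c c`_(k.*2) = c`_(k.*2.+1)) * (perm_a c c`_(k.*2.+1) = c`_(k.*2)).
Proof.
move=> kq.
have -> : perm_a c = (\prod_(i < q./2) tperm c`_(i.*2) c`_(i.*2.+1))%g.
  apply: eq_bigr => i _; rewrite cycle_perm2 // enumeration_eq.
  - by lia.
  - by have := ltn_ord i; lia.
  - by have := ltn_ord i; lia.
have bound (i : 'I_(q./2)) : (i.*2.+1 < q)%N by have := ltn_ord i; lia.
apply: (prod_disjoint_tperm (f := fun i : 'I_(q./2) => c`_(i.*2))
  (g := fun i : 'I_(q./2) => c`_(i.*2.+1)) (Ordinal kq)).
- move=> i j /eqP; rewrite enumeration_eq ?(ltnW (bound _)) // => /eqP E.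
  by apply/val_inj/double_inj.
- move=> i j /eqP; rewrite enumeration_eq ?bound // => /eqP[] E.
  by apply/val_inj/double_inj.
- move=> i j; rewrite enumeration_eq ?(ltnW (bound _)) ?bound //; lia.
Qed.

Lemma perm_a_sqr : ~~ odd q -> (perm_a c ^+ 2 = 1)%g.
Proof.
move=> q2; apply/permP=> x; rewrite expgS expg1 permM perm1.
have [k kq <-] := enumeration_nth x.
(* As [q] is even, every index has a partner. *)
have kq2 : (k./2 < q./2)%N by lia.
rewrite -(odd_double_half k); case: (odd k); rewrite ?add1n ?add0n;
  by rewrite !perm_aE.
Qed.

(** Conjugation by [a] takes each cycle of [b] to the inverse of the other, the second case
    following from the first by [a ^+ 2 = 1]. Inverting a product swaps its factors, so the two
    exchanges match. *)
Lemma perm_bJa : (4 %| q)%N -> (perm_b c ^ perm_a c = (perm_b c)^-1)%g.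
Proof.
move=> q4; set a := perm_a c.
rewrite /perm_b; set s1 := [seq _ | _ <- index_cycle1 q].
set s2 := [seq _ | _ <- index_cycle2 q].
have a_s1 : map a s1 = rot (q %/ 4) (rev s2).
  rewrite -map_rev -map_rot -map_succ_index_cycle1 -!map_comp.
  apply/eq_in_map => i /(index_cycle1_double q4)[k -> kq] /=.
  by rewrite /a perm_aE.
have us1 : uniq s1.
  rewrite map_inj_in_uniq ?index_cycle1_uniq // => i j.
  move=> /(index_cycle1_double q4)[k -> kq] /(index_cycle1_double q4)[l -> lq].
  by move=> /eqP; rewrite enumeration_eq => [/eqP||]; lia.
have us2 : uniq s2.
  by rewrite -rev_uniq -(rot_uniq (q %/ 4)) -a_s1 map_inj_uniq //; apply: perm_inj.
have J1 : (cycle_perm s1 ^ a = (cycle_perm s2)^-1)%g.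
  by rewrite cycle_permJ // a_s1 cycle_perm_rot ?rev_uniq // cycle_perm_rev.
have J2 : (cycle_perm s2 ^ a = (cycle_perm s1)^-1)%g.
  rewrite -[cycle_perm s2]invgK -J1 conjVg -conjgM.
  by have := perm_a_sqr; rewrite expgS expg1 => ->; rewrite ?conjg1 //; lia.
by rewrite conjMg J1 J2 invMg.
Qed.

(** The order of [b] is not read off its cycles; it comes from the relations and the order of the
    group. *)
Lemma group_ab_dihedral_pair n : (2 < n)%N -> (4 %| q)%N -> q = (2 * n)%N ->
  #|group_ab c| = q -> dihedral_pair n (perm_b c, perm_a c).
Proof.
move=> n2 q4 qE oG; apply: dihedral_pair_of_relations => //.
- by apply: perm_a_sqr; lia.
- exact: perm_bJa.
- by rewrite -qE -[RHS]oG setUC.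
Qed.

(** * Local permutation polynomials and their tuples *)

Lemma is_tuple_of_inj (f : {mpoly F[2]}) beta beta' : is_LPP f ->
  is_tuple_of c f beta -> is_tuple_of c f beta' -> beta = beta'.
Proof.
move=> Lf tb tb'; apply: eq_from_tnth => i; apply/permP=> x.
by apply: (bij_inj (Lf x).2); rewrite tb tb'.
Qed.

Lemma is_tuple_of_fixfree (f : {mpoly F[2]}) beta x i j : is_tuple_of c f beta ->
  tnth beta i x = tnth beta j x -> i = j.
Proof.
move=> tb E; have := tb i x; rewrite E tb !(tnth_nth 0) => /eqP.
by rewrite enumeration_eq // => /eqP/val_inj.
Qed.

(** Entries with distinct indices differ at every point, because [f] takes distinct values [c_i]
    there. *)
Lemma is_tuple_of_regular (f : {mpoly F[2]}) beta : is_tuple_of c f beta ->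
  uniq beta /\ regular [set s in beta].
Proof.
move=> tb; have ub : uniq beta.
  by apply/tuple_uniqP=> i j E; apply: (is_tuple_of_fixfree (x := 0) tb); rewrite E.
split=> //; apply/andP; split.
  by rewrite cardsE (card_uniqP ub) size_tuple oF.
apply/forallP=> x; apply/dinjectiveP=> s t.
rewrite !inE => /tnthP[i ->] /tnthP[j ->] E.
by rewrite (is_tuple_of_fixfree tb E).
Qed.

(** Interpolate the function sending [(x, y)] to [c_i] for the one [i] with [beta_i x = y];
    regularity makes this [i] exist and be unique. *)
Lemma exists_LPP_of_tuple (beta : q.-tuple {perm F}) :
  uniq beta -> regular [set s in beta] ->
  exists f : {mpoly F[2]}, [/\ reduced f, is_LPP f & is_tuple_of c f beta].
Proof.
move=> ub rb.
pose h x y := c`_(index y [seq (s : {perm F}) x | s <- beta]).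
have [f rf fE] := interpolation h.
have ht (i : 'I_q) x : h x (tnth beta i x) = tnth c i.
  rewrite /h (tnth_nth 0) (tnth_nth 1%g).
  rewrite -(nth_map 1%g 0 (fun s : {perm F} => s x)) ?size_tuple //.
  rewrite index_uniq ?size_map ?size_tuple // map_inj_in_uniq // => s t sb tb.
  by apply: (regular_inj rb); rewrite inE.
have surj x y : exists i, tnth beta i x = y.
  have [s + <-] := regular_surj x y rb.
  by rewrite inE => /tnthP[i ->]; exists i.
exists f; split=> // [z|i x]; last by rewrite fE ht.
split; apply: injF_bij => x y; rewrite !fE.
  (* Equal values force the same index [i], and then [beta_i x = z = beta_i y]. *)
  have [i iE] := surj x z; have [j jE] := surj y z.
  rewrite -{1}iE -jE !ht => /eqP; rewrite !(tnth_nth 0) enumeration_eq //.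
  move=> /eqP/val_inj E; apply: (@perm_inj _ (tnth beta i)).
  by rewrite iE E jE.
have [i <-] := surj z x; have [j <-] := surj z y.
by rewrite !ht => /eqP; rewrite !(tnth_nth 0) enumeration_eq // => /eqP/val_inj ->.
Qed.

(** When [#|F| = q], such a tuple has no repetition: its [q] entries fill a group of order [q]. *)
Definition group_tuples (G : {group {perm F}}) : {set q.-tuple {perm F}} :=
  [set beta : q.-tuple {perm F} |
    [exists H in regular_subgroups_isog G, [set s in beta] == H]].

(** Tuples are sorted by the group they fill, each group having [q!] orderings. [gen] recovers this
    group as a total function. *)
Lemma card_group_tuples G :
  #|group_tuples G| = (#|regular_subgroups_isog G| * q`!)%N.
Proof.
pose gen (beta : q.-tuple {perm F}) := <<[set s in beta]>>%G.
have genE (H : {group {perm F}}) beta : [set s in beta] = H -> gen beta = H.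
  by move=> E; apply: val_inj; rewrite /= E genGid.
rewrite -!sum1_card big_distrl /=.
rewrite (partition_big gen (mem (regular_subgroups_isog G))) /=; last first.
  by move=> beta; rewrite inE => /exists_inP[H HG /eqP/genE ->].
apply: eq_bigr => H HG; have := HG; rewrite inE mul1n => /andP[rH _].
have oH : #|H| = q by rewrite card_regular.
have <- : (#|H| ^_ q = q`!)%N by rewrite oH ffactnn.
rewrite -card_uniq_tuples -sum1_card.
apply: eq_bigl => beta; rewrite !inE.
apply/andP/andP => [[/exists_inP[K _ /eqP KE] /eqP gH]|[/allP sH ub]].
  have bH : [set s in beta] = H by rewrite KE -gH (genE _ _ KE).
  split.
    apply/allP=> s sb; suff: s \in [set s in beta] by rewrite bH.
    by rewrite inE.
  by apply/card_uniqP; rewrite -cardsE bH oH size_tuple.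
have bH : [set s in beta] = H.
  apply/eqP; rewrite eqEcard cardsE (card_uniqP ub) size_tuple oH leqnn andbT.
  by apply/subsetP=> s; rewrite inE => /sH.
by rewrite (genE _ _ bH) eqxx; split=> //; apply/exists_inP; exists H; rewrite ?bH.
Qed.

(** Choosing a reduced polynomial for each tuple gives the list: a polynomial determines its tuple,
    and a reduced one is determined by it. *)
Lemma has_card_same_form (f1 : {mpoly F[2]}) (G : {group {perm F}}) :
  corresponds_to c f1 G ->
  has_card (fun f => is_perm_group_poly c f /\ same_form c f1 f)
    #|group_tuples G|.
Proof.
move=> [rf1 Lf1 [beta1 tb1 bG1]].
have tupleP beta : beta \in group_tuples G ->
    exists2 H : {group {perm F}}, [set s in beta] = H & regular H /\ G \isog H.
  by rewrite inE => /exists_inP[H]; rewrite inE => /andP[? ?] /eqP; exists H.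
have [I IP] : exists I : q.-tuple {perm F} -> {mpoly F[2]},
    forall beta, beta \in group_tuples G ->
      [/\ reduced (I beta), is_LPP (I beta) & is_tuple_of c (I beta) beta].
  apply: (fin_all_exists (P := fun beta f => beta \in group_tuples G ->
      [/\ reduced f, is_LPP f & is_tuple_of c f beta])) => beta.
  (* Outside [group_tuples G] the choice is arbitrary, here 0. *)
  have [|?] := boolP (beta \in group_tuples G); last by exists 0.
  move=> /tupleP[H bH [rH _]].
  have [||f ?] := @exists_LPP_of_tuple beta; rewrite ?bH //; last by exists f.
  by apply/card_uniqP; rewrite -cardsE bH (card_regular rH) oF size_tuple.
exists [seq I beta | beta in group_tuples G]; split.
- rewrite map_inj_in_uniq ?enum_uniq // => beta beta'.
  rewrite !mem_enum => /IP[_ L tb] /IP[_ _ tb'] E.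
  by apply: is_tuple_of_inj L tb _; rewrite E.
- move=> f; split=> [/imageP[beta bG ->]|].
    have [rI LI tI] := IP _ bG; have [H bH [rH GH]] := tupleP _ bG.
    have cH : corresponds_to c (I beta) H by split=> //; exists beta.
    split; first by exists H.
    by exists G, H; split=> //; split=> //; exists beta1.
  case=> _ [H [K [[_ _ [beta1' tb1' bH]] [rf Lf [beta tb bK]] HK]]].
  (* [f1] has only one tuple, so the group witnessing [same_form] is [G] itself. *)
  have HG : H = G.
    by apply: val_inj; rewrite /= -bH -bG1 (is_tuple_of_inj Lf1 tb1 tb1').
  have [_ rK] := is_tuple_of_regular tb.
  have bG : beta \in group_tuples G.
    by rewrite inE; apply/exists_inP; exists K; rewrite ?bK // inE -bK rK bK -HG.
  have [rI LI tI] := IP _ bG.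
  (* Every point of the plane is [(x, beta_i x)] for some [i], and there both polynomials equal
     [c_i]. *)
  apply/imageP; exists beta => //; apply: reduced_eval2_inj => // x y.
  have [s + <-] := regular_surj x y rK.
  by rewrite inE => /tnthP[i ->]; rewrite tb tI.
- by rewrite size_map -cardE.
Qed.

End EnumeratedField.

(** * The final count *)

Import GRing.Theory Num.Theory.
Local Open Scope ring_scope.

Theorem theorem4p10 (m : nat) (hm : (3 <= m)%N)
    (F : finFieldType) (hF : #|F| = (2 ^ m)%N)
    (c : (2 ^ m).-tuple F) (hc : uniq c)
    (f1 : {mpoly F[2]}) (hf1 : corresponds_to c f1 (group_ab c)) :
  exists2 P_f1 : nat,
    has_card (fun f : {mpoly F[2]} => is_perm_group_poly c f /\ same_form c f1 f)
      P_f1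
    & P_f1%:R = ((2 ^ m)`!)%:R ^+ 2
                / (2%:R ^+ (2 * m - 1) * (totient (2 ^ (m - 1)))%:R) :> rat.
Proof.
exists #|group_tuples (2 ^ m) (group_ab c)|; first exact: has_card_same_form.
(* The tuple of [f1] makes the group regular, which also supplies its order. *)
have [_ _ [beta tb bG]] := hf1.
have [_ rG] := is_tuple_of_regular hF hc tb; rewrite bG in rG.
set n := (2 ^ (m - 1))%N.
have qE : (2 ^ m = 2 * n)%N by rewrite -expnS; congr (2 ^ _)%N; lia.
have n2 : (2 < n)%N by apply: (@leq_trans (2 ^ 2)) => //; rewrite leq_exp2l; lia.
have q4 : (4 %| 2 ^ m)%N by rewrite (dvdn_exp2l 2 (m := 2)) //; lia.
have D := group_ab_dihedral_pair hF hc n2 q4 qE (etrans (card_regular rG) hF).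
have N := card_regular_subgroups_isog n2 (etrans hF qE) D
  (congr1 (fun A : {set {perm F}} => <<A>>%g) (setUC _ _)) rG.
have pw : (2 ^ (2 * m - 1) = n * 2 ^ m)%N by rewrite -expnD; congr (2 ^ _)%N; lia.
have phi0 : (totient n)%:R != 0 :> rat.
  by rewrite pnatr_eq0 -lt0n totient_gt0; lia.
rewrite card_group_tuples //; apply: (canRL (mulfK _)).
  by rewrite mulf_neq0 // expf_neq0 // pnatr_eq0.
rewrite -!natrX -!natrM pw expnS expn1; congr _%:R.
(* With denominators cleared, one factor [q!] on the right is replaced by the product that [N]
   equates with it. *)
by rewrite hF in N; rewrite -[X in _ = (X * _)%N]N; ring.
Qed.
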